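(* Let $n$ be a positive integer and let $\pi=\pi_1\pi_2\ldots\pi_n$ be a permutation of $\{1,\ldots,n\}$ with inversion table $I(\pi)=(a_1,a_2,\ldots,a_n)$. Then $\pi$ is valleyless if and only if $a_k\in\{0,\,n-k\}$ for every $k=1,2,\ldots,n$.
   Context: The inversion table of a permutation $\pi=\pi_1\ldots\pi_n$ of $\{1,\ldots,n\}$ is $(a_1,\ldots,a_n)$, where $a_k$ is the number of entries of the word $\pi$ that lie to the left of the entry $k$ and are greater than $k$. A sequence $s_1,\ldots,s_n$ is valleyless if for all $1\le i<j<k\le n$ one has $s_j\ge\min\{s_i,s_k\}$. *)

(* Defs.v *)
From mathcomp Require Import all_boot all_fingroup.

Set Implicit Arguments.
Unset Strict Implicit.
Unset Printing Implicit Defensive.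

(* A permutation of {1, ..., n} is p : 'S_n, where the ordinal i : 'I_n stands
   for the position, respectively the entry, i.+1.  So pi_(i+1) = word p i. *)
Definition word (n : nat) (p : 'S_n) (i : 'I_n) : nat := (p i).+1.

(* invtable p k is a_(k+1).  The entry k.+1 is at the position (p^-1)%g k. *)
Definition invtable (n : nat) (p : 'S_n) (k : 'I_n) : nat :=
  #|[set j : 'I_n | (j < (p^-1)%g k) && (k.+1 < word p j)]|.

Definition valleyless (n : nat) (s : 'I_n -> nat) : Prop :=
  forall i j k : 'I_n, i < j -> j < k -> minn (s i) (s k) <= s j.

(* Main.v *)
Require Import Defs.
From mathcomp Require Import all_boot all_fingroup.

(** There are exactly [n - k] entries larger than [k].  Hence [a_k] avoids both
    [0] and [n - k] exactly when [k] has larger entries on both of its sides,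
    that is, when [k] is the bottom of a valley. *)

Lemma card_ord_gt (n k : nat) : #|[set m : 'I_n | k < m]| = n - k.+1.
Proof.
rewrite -sum1dep_card -(big_geq_mkord k.+1 n xpredT (fun=> 1)).
by rewrite sum_nat_const_nat muln1.
Qed.

(** The set is the preimage of the ordinals above [k] under the injective map [p], so the two have
    equal size. *)
Lemma card_perm_gt (n : nat) (p : 'S_n) (k : nat) :
  #|[set j : 'I_n | k < p j]| = n - k.+1.
Proof.
rewrite -card_ord_gt -(card_preimset [set m : 'I_n | k < m] (@perm_inj _ p)).
by congr #|pred_of_set _|; apply/setP=> j; rewrite !inE.
Qed.

(** The weak [<=] suffices: [k < p j] already excludes that [j] is the position of [k]. *)
Lemma invtable_eq0P (n : nat) (p : 'S_n) (k : 'I_n) :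
  reflect (forall j : 'I_n, k < p j -> (p^-1)%g k <= j) (invtable p k == 0).
Proof.
rewrite cards_eq0; apply: (iffP eqP) => [L0 j ltkj | H].
  by have /setP/(_ j) := L0; rewrite !inE ltnS ltkj andbT ltnNge => /negbFE.
by apply/setP=> j; rewrite !inE ltnS ltnNge; apply/negP=> /andP[/negP + /H].
Qed.

(** The positions counted by [invtable p k] form a subset [L] of the set [G] of all positions of
    larger entries, so equal cardinality forces [L = G]. *)
Lemma invtable_eqmaxP (n : nat) (p : 'S_n) (k : 'I_n) :
  reflect (forall j : 'I_n, k < p j -> j < (p^-1)%g k)
          (invtable p k == n - k.+1).
Proof.
rewrite -(card_perm_gt _ p k) /invtable.
set L := [set j | _ && _]; set G := [set j | _].
have sLG : L \subset G by apply/subsetP=> j; rewrite !inE => /andP[].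
rewrite eqn_leq subset_leq_card //=.
have -> : (#|G| <= #|L|) = (G \subset L).
  apply/idP/idP=> [leGL | /subset_leq_card //].
  by have /eqP <- : L == G by rewrite eqEcard sLG.
apply: (iffP subsetP) => H j.
  by move=> ltkj; have := H j; rewrite !inE => /(_ ltkj)/andP[].
by rewrite !inE ltnS => ltkj; rewrite ltkj H.
Qed.

Theorem theorem2 (n : nat) (n_gt0 : 0 < n) (p : 'S_n) :
  valleyless (word p) <->
  (forall k : 'I_n, invtable p k = 0 \/ invtable p k = n - k.+1).
Proof.
split=> [vl k | H i j k ltij ltjk].
  case: (invtable_eq0P _ p k) => [|L_neq0]; [by left; apply/eqP/invtable_eq0P | right].
  apply/eqP/invtable_eqmaxP=> j ltkj; rewrite ltnNge; apply/negP=> le_kj.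
  apply: L_neq0 => i ltki; rewrite leqNgt; apply/negP=> lt_ik.
  (* Equality would put the entry [k] itself at position [j], which holds a larger one. *)
  have lt_kj : (p^-1)%g k < j.
    rewrite ltn_neqAle le_kj andbT; apply/negP=> /eqP/val_inj eq_kj.
    by rewrite -eq_kj permKV ltnn in ltkj.
  (* Larger entries at [i] and [j] surround [k]: a forbidden valley. *)
  have := vl _ _ _ lt_ik lt_kj.
  by rewrite /word permKV geq_min !ltnS leqNgt ltki leqNgt ltkj.
rewrite leqNgt; apply/negP; rewrite /word leq_min !ltnS => /andP[ltji ltjk'].
(* For the valley bottom [p j], the larger entry on its left rules out 0 and the one on its right
   rules out the maximum. *)
case: (H (p j)) => /eqP => [/invtable_eq0P/(_ i ltji) | /invtable_eqmaxP/(_ k ltjk')];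
  rewrite permK.
  by rewrite leqNgt ltij.
by rewrite ltnNge ltnW.
Qed.
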